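(* (1) If $f:Q\to Q'$ is a morphism of precoherent prequantales, then the map $\mathsf{K}(f):\mathsf{K}(Q)\to\mathsf{K}(Q')$ given by $\mathsf{K}(f)(x)=f(x)$ for all $x\in\mathsf{K}(Q)$ is a morphism of prequantic semilattices. (2) If $g:M\to M'$ is a morphism of prequantic semilattices, then the map $\mathrm{Idl}(g):\mathrm{Idl}(M)\to\mathrm{Idl}(M')$ given by $\mathrm{Idl}(g)(I)=\,\downarrow\!(g(I))$ for all $I\in\mathrm{Idl}(M)$ is a morphism of precoherent prequantales, where $\mathrm{Idl}(M)$ and $\mathrm{Idl}(M')$ are equipped with $\downarrow$-multiplication. (3) The associations $\mathsf{K}$ and $\mathrm{Idl}$ are functorial and provide an equivalence of categories between the category of precoherent prequantales and the category of prequantic semilattices.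
   Context: An ordered magma is a set with a binary operation (written multiplicatively, not assumed associative, commutative or unital) and a partial order such that $x\le x'$ and $y\le y'$ imply $xy\le x'y'$. A prequantale is an ordered magma $Q$ such that for every subset $X$ of $Q$ (including the empty set), $\bigvee X$ exists and $a(\bigvee X)=\bigvee(aX)$, $(\bigvee X)a=\bigvee(Xa)$ for all $a\in Q$. A prequantic semilattice is an ordered magma $M$ in which any two elements have a supremum, $a(x\vee y)=ax\vee ay$ and $(x\vee y)a=xa\vee ya$ for all $a,x,y\in M$, and which has a least element $0$ satisfying $0x=0=x0$ for all $x\in M$; a morphism of prequantic semilattices is a magma homomorphism $g$ with $g(\bigvee X)=\bigvee g(X)$ for all finite $X$ (including $X=\emptyset$). A directed subset of a poset is a nonempty subset $\Delta$ such that every finite subset of $\Delta$ has an upper bound in $\Delta$. An element $x$ of a poset $S$ is compact if whenever $x\le\bigvee\Delta$ for a directed $\Delta\subset S$ whose supremum exists, one has $x\le y$ for some $y\in\Delta$; $\mathsf{K}(S)$ is the set of compact elements of $S$. An ordered magma is precoherent if every element is a supremum of a set of compact elements and its set of compact elements is closed under multiplication; $\mathsf{K}(Q)$ carries the induced order and multiplication. A morphism of precoherent prequantales is a magma homomorphism $f:Q\to Q'$ with $f(\bigvee X)=\bigvee f(X)$ for all $X\subset Q$ and $f(\mathsf{K}(Q))\subset\mathsf{K}(Q')$. An ideal of a poset is a directed downward closed subset; $\mathrm{Idl}(S)$ is the set of ideals of $S$ ordered by inclusion. For a nonempty subset $X$ of a join semilattice $S$, $\downarrow\! X=\{y\in S: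 y\le\bigvee T\text{ for some finite nonempty }T\subset X\}$. $\downarrow$-multiplication on $\mathrm{Idl}(M)$ is $(I,J)\mapsto\,\downarrow\!(IJ)$, where $IJ=\{xy:x\in I,y\in J\}$. *)

(* Defs.v *)
From HB Require Import structures.
From mathcomp Require Import all_boot all_order.
From mathcomp Require Import boolp classical_sets cardinality.

Set Implicit Arguments.
Unset Strict Implicit.
Unset Printing Implicit Defensive.

Import Order.TTheory.
Local Open Scope classical_set_scope.
Local Open Scope group_scope.
Local Open Scope order_scope.

Definition directed d (S : porderType d) (D : set S) : Prop :=
  D !=set0 /\
  forall F : set S, finite_set F -> F `<=` D -> exists2 u, D u & ubound F u.

Definition compact d (S : porderType d) (x : S) : Prop :=
  forall (D : set S) (s : S), directed D -> isLub D s -> x <= s ->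
    exists2 y, D y & x <= y.

Definition compacts d (S : porderType d) : set S := [set x | compact x].
Arguments compacts {d} S.

Definition ideal d (S : porderType d) (I : set S) : Prop :=
  directed I /\ forall x y, I y -> x <= y -> I x.

Definition ideals d (S : porderType d) : set (set S) := [set I | ideal I].
Arguments ideals {d} S.

(* The suprema [isLub T s] always exist when [S] is a join semilattice; this is
   not [classical_sets.down], which does not close under finite suprema. *)
Definition down_join d (S : porderType d) (X : set S) : set S :=
  [set y | exists (T : set S) (s : S),
     [/\ finite_set T, T !=set0, T `<=` X, isLub T s & y <= s]].

HB.mixin Record Magma_POrder_isOrderedMagma d M
    of Magma M & Order.POrder d M := {
  le_mulg2 : forall x x' y y' : M,
    x <= x' -> y <= y' -> (x * y)%g <= (x' * y')%g
}.

#[short(type="orderedMagmaType")]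
HB.structure Definition OrderedMagma d :=
  { M of Magma_POrder_isOrderedMagma d M & Magma M & Order.POrder d M }.

Definition prequantale d (Q : orderedMagmaType d) : Prop :=
  forall X : set Q, exists2 s, isLub X s &
    forall a : Q, isLub [set (a * x)%g | x in X] (a * s)%g /\
                  isLub [set (x * a)%g | x in X] (s * a)%g.

Definition precoherent d (Q : orderedMagmaType d) : Prop :=
  (forall x : Q, exists2 X : set Q, X `<=` compacts Q & isLub X x) /\
  (forall x y : Q, compact x -> compact y -> compact (x * y)%g).

Definition precoherent_prequantale d (Q : orderedMagmaType d) : Prop :=
  prequantale Q /\ precoherent Q.

Definition prequantic_semilattice d (M : orderedMagmaType d) : Prop :=
  (forall x y : M, exists2 s, isLub [set x; y] s &
     forall a : M, isLub [set (a * x)%g; (a * y)%g] (a * s)%g /\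
                   isLub [set (x * a)%g; (y * a)%g] (s * a)%g) /\
  (exists2 z : M, forall x : M, z <= x &
     forall x : M, (z * x = z)%g /\ (x * z = z)%g).

Definition pq_morphism d (Q Q' : orderedMagmaType d) (f : Q -> Q') : Prop :=
  [/\ {morph f : x y / (x * y)%g},
      forall (X : set Q) (s : Q), isLub X s -> isLub (f @` X) (f s)
    & forall x : Q, compact x -> compact (f x)].

Definition psl_morphism d (M M' : orderedMagmaType d) (g : M -> M') : Prop :=
  {morph g : x y / (x * y)%g} /\
  forall (X : set M) (s : M), finite_set X -> isLub X s -> isLub (g @` X) (g s).

Record precoherentPrequantale d := PrecoherentPrequantale {
  pq_sort :> orderedMagmaType d;
  pqP : precoherent_prequantale pq_sort }.

Record prequanticSemilattice d := PrequanticSemilattice {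
  psl_sort :> orderedMagmaType d;
  pslP : prequantic_semilattice psl_sort }.

Definition pq_hom d (Q Q' : precoherentPrequantale d) : Type :=
  {f : Q -> Q' | pq_morphism f}.

Definition psl_hom d (M M' : prequanticSemilattice d) : Type :=
  {g : M -> M' | psl_morphism g}.

Definition K d (Q : precoherentPrequantale d) : Type := set_type (compacts Q).

Section CompactElements.
Context {d : Order.disp_t}.
Implicit Types Q : precoherentPrequantale d.

HB.instance Definition _ Q := Choice.on (K Q).
HB.instance Definition _ Q := SubType.on (K Q).
HB.instance Definition _ Q := [SubChoice_isSubPOrder of K Q by <: with d].

Lemma K_compact Q (x : K Q) : compact (val x).
Proof. exact: set_valP. Qed.
Arguments K_compact {Q} x.

Definition toK Q (x : Q) (cx : compact x) : K Q := exist _ x (mem_set cx).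

Definition K_mul Q (x y : K Q) : K Q :=
  toK ((pqP Q).2.2 _ _ (K_compact x) (K_compact y)).

HB.instance Definition _ Q := hasMul.Build (K Q) (@K_mul Q).

Lemma K_le_mul Q (x x' y y' : K Q) :
  x <= x' -> y <= y' -> (x * y)%g <= (x' * y')%g.
Proof. by rewrite -!Order.le_val => lx ly; exact: le_mulg2. Qed.

HB.instance Definition _ Q :=
  Magma_POrder_isOrderedMagma.Build d (K Q) (@K_le_mul Q).

Lemma pq_hom_compact Q Q' (f : pq_hom Q Q') (x : K Q) :
  compact (sval f (val x)).
Proof. by case: f => f [_ _ /=]; apply; exact: K_compact. Qed.
Arguments pq_hom_compact {Q Q'} f x.

Definition K_map Q Q' (f : pq_hom Q Q') (x : K Q) : K Q' :=
  toK (pq_hom_compact f x).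

End CompactElements.

(* [set M] is ordered by inclusion, and [Idl M] carries the induced order. *)
Definition Idl d (M : prequanticSemilattice d) : Type := set_type (ideals M).

Section Ideals.
Context {d : Order.disp_t}.
Implicit Types M : prequanticSemilattice d.

HB.instance Definition _ M := Choice.on (Idl M).
HB.instance Definition _ M := SubType.on (Idl M).
HB.instance Definition _ M := [SubChoice_isSubPOrder of Idl M by <: with d].

Lemma Idl_ideal M (I : Idl M) : ideal (val I).
Proof. exact: set_valP. Qed.

Lemma directed2 (S : porderType d) (D : set S) :
  D !=set0 -> (forall x y, D x -> D y -> exists2 u, D u & x <= u /\ y <= u) ->
  directed D.
Proof.
move=> D0 D2; split=> // F /finite_seqP[s ->{F}].
elim: s => [_|x s IHs sD]; first by have [u Du] := D0; exists u => // v.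
have [|u Du su] := IHs; first by move=> y /= ys; apply: sD; rewrite /= inE ys orbT.
have [|v Dv [xv uv]] := D2 x u _ Du; first by apply: sD; rewrite /= inE eqxx.
exists v => // y; rewrite /= inE => /orP[/eqP->//|ys].
exact: le_trans (su _ ys) uv.
Qed.

Lemma down_join_ideal M (X : set M) : X !=set0 -> ideal (down_join X).
Proof.
move=> [x Xx]; split; last first.
  move=> y z [T [s [fT T0 TX Ts zs]]] yz.
  by exists T, s; split=> //; exact: le_trans yz zs.
apply: directed2.
  exists x, [set x], x; split=> //; first by exists x.
    by move=> _ ->.
  by split=> [_ ->//|b]; exact.
move=> y1 y2 [T1 [s1 [fT1 [t1 Tt1] T1X [ub1 lub1] ys1]]].
move=> [T2 [s2 [fT2 T20 T2X [ub2 lub2] ys2]]].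
have [s [ub lub] _] := (pslP M).1 s1 s2.
have s1s : s1 <= s by apply: ub; left.
have s2s : s2 <= s by apply: ub; right.
exists s; last by split; [exact: le_trans ys1 s1s|exact: le_trans ys2 s2s].
exists (T1 `|` T2), s; split=> //.
- by rewrite finite_setU.
- by exists t1; left.
- by move=> t [/T1X|/T2X].
split=> [t [/ub1 ts|/ub2 ts]|b bb].
- exact: le_trans ts s1s.
- exact: le_trans ts s2s.
by apply: lub => _ [->|->]; [apply: lub1|apply: lub2] => t Tt; apply: bb;
  [left|right].
Qed.

Definition toIdl M (I : set M) (iI : ideal I) : Idl M := exist _ I (mem_set iI).

Definition set_mul M (X Y : set M) : set M :=
  [set (x * y)%g | x in X & y in Y].

Lemma set_mul_neq0 M (I J : Idl M) : set_mul (val I) (val J) !=set0.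
Proof.
have [[[x Ix] _] _] := Idl_ideal I; have [[[y Jy] _] _] := Idl_ideal J.
by exists (x * y)%g, x => //; exists y.
Qed.

Definition Idl_mul M (I J : Idl M) : Idl M :=
  toIdl (down_join_ideal (set_mul_neq0 I J)).

HB.instance Definition _ M := hasMul.Build (Idl M) (@Idl_mul M).

Lemma Idl_le_mul M (I I' J J' : Idl M) :
  I <= I' -> J <= J' -> (I * J)%g <= (I' * J')%g.
Proof.
rewrite -!Order.le_val !subsetEset => II' JJ' z [T [s [fT T0 TX Ts zs]]].
exists T, s; split=> // t /TX[x Ix [y Jy <-]].
by exists x; [exact: II'|exists y => //; exact: JJ'].
Qed.

HB.instance Definition _ M :=
  Magma_POrder_isOrderedMagma.Build d (Idl M) (@Idl_le_mul M).

Lemma image_Idl_neq0 M M' (g : M -> M') (I : Idl M) : g @` val I !=set0.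
Proof. by have [[[x Ix] _] _] := Idl_ideal I; exists (g x), x. Qed.

Definition Idl_map M M' (g : psl_hom M M') (I : Idl M) : Idl M' :=
  toIdl (down_join_ideal (image_Idl_neq0 (sval g) I)).

End Ideals.

Record category := Category {
  ob :> Type;
  hom : ob -> ob -> Type;
  idm : forall a, hom a a;
  compm : forall a b c, hom b c -> hom a b -> hom a c;
  comp_idl : forall a b (f : hom a b), compm (idm b) f = f;
  comp_idr : forall a b (f : hom a b), compm f (idm a) = f;
  comp_assoc : forall a b c e (h : hom c e) (g : hom b c) (f : hom a b),
    compm h (compm g f) = compm (compm h g) f }.

Arguments hom {C} a b : rename.
Arguments idm {C} a : rename.
Arguments compm {C} {a b c} g f : rename.

(* The data of a functor, without its laws. *)
Record prefunctor (C D : category) := Prefunctor {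
  fob :> C -> D;
  fmor : forall a b : C, hom a b -> hom (fob a) (fob b) }.

Arguments fmor {C D} F {a b} f : rename.

Definition functorial (C D : category) (F : prefunctor C D) : Prop :=
  (forall a : C, fmor F (idm a) = idm (F a)) /\
  (forall (a b c : C) (g : hom b c) (f : hom a b),
     fmor F (compm g f) = compm (fmor F g) (fmor F f)).

Definition idF (C : category) : prefunctor C C :=
  @Prefunctor C C (fun a => a) (fun _ _ f => f).

Definition compF (C D E : category) (G : prefunctor D E) (F : prefunctor C D) :
    prefunctor C E :=
  @Prefunctor C E (fun a => G (F a)) (fun _ _ f => fmor G (fmor F f)).

Definition is_iso (C : category) (a b : C) (f : hom a b) : Prop :=
  exists2 g : hom b a, compm g f = idm a & compm f g = idm b.

Definition naturally_isomorphic (C D : category) (F G : prefunctor C D) : Prop :=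
  exists2 eta : forall a : C, hom (F a) (G a), forall a, is_iso (eta a) &
    forall (a b : C) (f : hom a b),
      compm (eta b) (fmor F f) = compm (fmor G f) (eta a).

Definition category_equivalence (C D : category)
    (F : prefunctor C D) (G : prefunctor D C) : Prop :=
  [/\ functorial F, functorial G,
      naturally_isomorphic (compF G F) (idF C)
    & naturally_isomorphic (compF F G) (idF D)].

Section PQ.
Context {d : Order.disp_t}.
Implicit Types Q : precoherentPrequantale d.

Lemma pq_morphism_id Q : pq_morphism (@id Q).
Proof. by split=> // X s; rewrite image_id. Qed.

Lemma pq_morphism_comp Q Q' Q'' (g : Q' -> Q'') (f : Q -> Q') :
  pq_morphism g -> pq_morphism f -> pq_morphism (g \o f).
Proof.
move=> [gM gS gK] [fM fS fK]; split=> [x y|X s Xs|x cx] /=.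
- by rewrite fM gM.
- by rewrite -image_comp; apply/gS/fS.
- exact/gK/fK.
Qed.

Definition pq_id Q : pq_hom Q Q := exist _ id (pq_morphism_id Q).

Definition pq_comp Q Q' Q'' (g : pq_hom Q' Q'') (f : pq_hom Q Q') :
  pq_hom Q Q'' := exist _ _ (pq_morphism_comp (svalP g) (svalP f)).

Lemma pq_hom_eq Q Q' (f g : pq_hom Q Q') : sval f = sval g -> f = g.
Proof.
by case: f g => [f fP] [g gP] /= e; subst g; rewrite (Prop_irrelevance fP gP).
Qed.

End PQ.

Definition PQ (d : Order.disp_t) : category.
Proof.
by refine (@Category (precoherentPrequantale d) (@pq_hom d) (@pq_id d)
  (@pq_comp d) _ _ _) => *; exact: pq_hom_eq.
Defined.

Section PSL.
Context {d : Order.disp_t}.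
Implicit Types M : prequanticSemilattice d.

Lemma psl_morphism_id M : psl_morphism (@id M).
Proof. by split=> // X s; rewrite image_id. Qed.

Lemma psl_morphism_comp M M' M'' (g : M' -> M'') (f : M -> M') :
  psl_morphism g -> psl_morphism f -> psl_morphism (g \o f).
Proof.
move=> [gM gS] [fM fS]; split=> [x y|X s fX Xs] /=; first by rewrite fM gM.
rewrite -image_comp; apply: gS; first exact: finite_image.
exact: fS.
Qed.

Definition psl_id M : psl_hom M M := exist _ id (psl_morphism_id M).

Definition psl_comp M M' M'' (g : psl_hom M' M'') (f : psl_hom M M') :
  psl_hom M M'' := exist _ _ (psl_morphism_comp (svalP g) (svalP f)).

Lemma psl_hom_eq M M' (f g : psl_hom M M') : sval f = sval g -> f = g.
Proof.
by case: f g => [f fP] [g gP] /= e; subst g; rewrite (Prop_irrelevance fP gP).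
Qed.

End PSL.

Definition PSL (d : Order.disp_t) : category.
Proof.
by refine (@Category (prequanticSemilattice d) (@psl_hom d) (@psl_id d)
  (@psl_comp d) _ _ _) => *; exact: psl_hom_eq.
Defined.

(* The associations [K] and [Idl] on objects and morphisms, given proofs that
   they take values in objects and morphisms of the target category. *)
Definition K_functor d
    (K_ob : forall Q : precoherentPrequantale d, prequantic_semilattice (K Q))
    (K_mor : forall (Q Q' : precoherentPrequantale d) (f : pq_hom Q Q'),
       psl_morphism (K_map f)) : prefunctor (PQ d) (PSL d) :=
  @Prefunctor (PQ d) (PSL d) (fun Q => PrequanticSemilattice (K_ob Q))
    (fun Q Q' f => exist _ (K_map f) (K_mor Q Q' f)).

Definition Idl_functor d
    (Idl_ob : forall M : prequanticSemilattice d, precoherent_prequantale (Idl M))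
    (Idl_mor : forall (M M' : prequanticSemilattice d) (g : psl_hom M M'),
       pq_morphism (Idl_map g)) : prefunctor (PSL d) (PQ d) :=
  @Prefunctor (PSL d) (PQ d) (fun M => PrecoherentPrequantale (Idl_ob M))
    (fun M M' g => exist _ (Idl_map g) (Idl_mor M M' g)).

(* Main.v *)
(* The key fact is that the preimage of an ideal under a map preserving [0] and
   binary joins is an ideal. For ideals this makes [I * J <= B] and
   [Idl_map g I <= B] checkable on elements of [I] and [J], and it turns the
   statements that multiplication by an ideal and [Idl_map g] preserve all
   suprema into residuation arguments: the bounding condition on an ideal [s]
   reads [s <= B'] for an ideal [B'] of preimages. The compact elements of
   [Idl M] are the principal ideals, so [x |-> {y | y <= x}] is an isomorphism
   [M -> K (Idl M)]; conversely [x |-> {k compact | k <= x}] is an isomorphism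
   [Q -> Idl (K Q)], with inverse the supremum. *)
Require Import Defs.
From HB Require Import structures.
From mathcomp Require Import all_boot all_order.
From mathcomp Require Import boolp classical_sets cardinality.

Set Implicit Arguments.
Unset Strict Implicit.
Unset Printing Implicit Defensive.

Import Order.TTheory.
Local Open Scope classical_set_scope.
Local Open Scope order_scope.

(** * Suprema, directed sets and compact elements in posets *)

Section Suprema.
Context {d d' : Order.disp_t} {S : porderType d} {S' : porderType d'}.

(** Encodes an inequality as a binary supremum, so that maps preserving such suprema are seen to be
    monotone. *)
Lemma isLub2_le (x y : S) : x <= y -> isLub [set x; y] y.
Proof.
by move=> xy; split=> [_ [->|->]//|b bb]; apply: bb; right.
Qed.

Lemma isLub_set0 (z : S) : isLub set0 z <-> forall x, z <= x.
Proof.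
by split=> [[_ zle] x|zle]; [apply: zle|split=> // b _].
Qed.

Lemma directed_image (f : S -> S') (D : set S) :
  {homo f : x y / x <= y} -> directed D -> directed (f @` D).
Proof.
move=> fle [[x Dx] dD]; apply: directed2; first by exists (f x), x.
move=> _ _ [y Dy <-] [z Dz <-].
have [||u Du ub] := dD [set y; z]; first exact: finite_set2.
  by move=> _ [->|->].
by exists (f u); [exists u|split; apply/fle/ub; [left|right]].
Qed.

Lemma directed_isLub_compact (D : set S) (s x : S) :
  directed D -> isLub D s -> compact x -> x <= s -> exists2 y, D y & x <= y.
Proof. by move=> dD Ds cx; apply: cx. Qed.

(** Each member of [X] lies below some element of [D], and these finitely many elements have an
    upper bound in [D]. The case of empty [X] makes a least element compact. *)
Lemma compact_isLub (X : set S) (s : S) :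
  finite_set X -> X `<=` compacts S -> isLub X s -> compact s.
Proof.
move=> fX cX [ubs lubs] D t dD Dt st.
(* Guarding by [X x] makes the choice function total; outside [X] its value is a dummy. *)
have /choice[h hP] x : exists y, X x -> D y /\ x <= y.
  have [Xx|nXx] := pselect (X x); last by exists x.
  have [y Dy xy] := cX _ Xx D t dD Dt (le_trans (ubs _ Xx) st).
  by exists y.
have [||u Du ub] := dD.2 (h @` X); first exact: finite_image.
  by move=> _ [x Xx <-]; case: (hP x Xx).
exists u => //; apply: lubs => x Xx; apply: le_trans (hP x Xx).2 _.
by apply: ub; exists x.
Qed.

Lemma isLub_iso (h : S -> S') (X : set S) (s : S) :
  bijective h -> {mono h : x y / x <= y} -> isLub X s -> isLub (h @` X) (h s).
Proof.
move=> [k hK kK] hle [ub lub]; split=> [_ [x Xx <-]|b bb]; first by rewrite hle; exact: ub.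
rewrite -(kK b) hle; apply: lub => x Xx.
by rewrite -hle kK; apply: bb; exists x.
Qed.

End Suprema.

(** * Order isomorphisms as isomorphisms in both categories *)

Lemma mono_bij d d' (S : porderType d) (S' : porderType d') (h : S -> S') :
  {mono h : x y / x <= y} -> (forall y, exists x, h x = y) -> bijective h.
Proof.
move=> hle /choice[k kK]; exists k => // x.
by apply: le_anti; rewrite -!hle !kK !lexx.
Qed.

Lemma compact_iso d d' (S : porderType d) (S' : porderType d') (h : S -> S') x :
  bijective h -> {mono h : x y / x <= y} -> compact x -> compact (h x).
Proof.
move=> [k hK kK] hle cx D s dD Ds hxs.
have kle : {mono k : x y / x <= y} by move=> y z; rewrite -hle !kK.
have kbij : bijective k by exists h.
have [|||_ [z Dz <-] xz] := cx (k @` D) (k s).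
- by apply: directed_image => // y z; rewrite kle.
- exact: isLub_iso.
- by rewrite -hle kK.
by exists z => //; rewrite -(kK z) hle.
Qed.

(** Suprema and compactness are order-theoretic, so an order isomorphism preserves them and only
    multiplicativity has to be assumed. *)
Lemma pq_morphism_iso d (Q Q' : orderedMagmaType d) (h : Q -> Q') :
  bijective h -> {mono h : x y / x <= y} -> {morph h : x y / (x * y)%g} ->
  pq_morphism h.
Proof.
move=> hbij hle hM; split=> // [X s|x]; first exact: isLub_iso.
exact: compact_iso.
Qed.

Lemma psl_morphism_iso d (M M' : orderedMagmaType d) (h : M -> M') :
  bijective h -> {mono h : x y / x <= y} -> {morph h : x y / (x * y)%g} ->
  psl_morphism h.
Proof. by move=> hbij hle hM; split=> // X s _; exact: isLub_iso. Qed.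

Lemma is_iso_PQ d (Q Q' : PQ d) (f : hom Q Q') :
  bijective (sval f) -> {mono sval f : x y / x <= y} -> is_iso f.
Proof.
move=> [k fK kK] fle; have fM : {morph sval f : x y / (x * y)%g}.
  by have [] := svalP f.
have kP : pq_morphism k.
  apply: pq_morphism_iso; first by exists (sval f).
    by move=> x y; rewrite -fle !kK.
  by move=> x y; rewrite -{1}(kK x) -{1}(kK y) -fM fK.
by exists (exist _ k kP); apply: pq_hom_eq; apply/funext => x /=.
Qed.

Lemma is_iso_PSL d (M M' : PSL d) (f : hom M M') :
  bijective (sval f) -> {mono sval f : x y / x <= y} -> is_iso f.
Proof.
move=> [k fK kK] fle; have fM : {morph sval f : x y / (x * y)%g}.
  by have [] := svalP f.
have kP : psl_morphism k.
  apply: psl_morphism_iso; first by exists (sval f).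
    by move=> x y; rewrite -fle !kK.
  by move=> x y; rewrite -{1}(kK x) -{1}(kK y) -fM fK.
by exists (exist _ k kP); apply: psl_hom_eq; apply/funext => x /=.
Qed.

(** Lets the natural isomorphisms be built starting from the identity functors, where the components
    have explicit formulas. *)
Lemma naturally_isomorphic_sym (C D : category) (F G : prefunctor C D) :
  naturally_isomorphic F G -> naturally_isomorphic G F.
Proof.
move=> [eta iso nat].
have inv a : {g : hom (G a) (F a) |
    compm g (eta a) = idm (F a) & compm (eta a) g = idm (G a)}.
  by apply: cid2; exact: iso.
pose th a := s2val (inv a).
have thl a : compm (th a) (eta a) = idm (F a) := s2valP (inv a).
have thr a : compm (eta a) (th a) = idm (G a) := s2valP' (inv a).
exists th => [a|a b f]; first by exists (eta a).
(* Insert [eta a] composed with [th a] on the right, move [eta] past [f] by naturality, then cancel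
   it against [th b]. *)
rewrite -[LHS]comp_idr -(thr a) comp_assoc -(comp_assoc (th b)) -nat.
by rewrite !comp_assoc thl comp_idl.
Qed.

(** * The prequantic semilattice of compact elements *)

Section Compacts.
Context {d : Order.disp_t}.
Implicit Types Q : precoherentPrequantale d.

Lemma K_leE Q (x y : K Q) : (x <= y) = (val x <= val y).
Proof. by rewrite Order.le_val. Qed.

Lemma isLub_K Q (X : set (K Q)) (s : K Q) :
  isLub (val @` X) (val s) -> isLub X s.
Proof.
move=> [ub lub]; split=> [x Xx|b bb]; first by rewrite K_leE; apply: ub; exists x.
by rewrite K_leE; apply: lub => _ [x Xx <-]; rewrite -K_leE; exact: bb.
Qed.

(** The supremum in [Q] of finitely many compact elements is compact, so it lies in [K Q] and agrees
    with the supremum there. *)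
Lemma isLub_val Q (X : set (K Q)) (s : K Q) :
  finite_set X -> isLub X s -> isLub (val @` X) (val s).
Proof.
move=> fX [ub lub]; have [t tX _] := (pqP Q).1 (val @` X).
have ct : compact t.
  apply: (compact_isLub _ _ tX); first exact: finite_image.
  by move=> _ [x Xx <-]; exact: K_compact.
split=> [_ [x Xx <-]|b bb]; first by rewrite -K_leE; exact: ub.
apply: (@le_trans _ _ t); last exact: tX.2.
rewrite -[t]/(val (toK ct)) -K_leE; apply: lub => x Xx.
by rewrite K_leE; apply: tX.1; exists x.
Qed.

Lemma K_prequantic Q : prequantic_semilattice (K Q).
Proof.
split=> [x y|].
  have [s sxy sM] := (pqP Q).1 [set val x; val y].
  have cs : compact s.
    apply: (compact_isLub _ _ sxy); first exact: finite_set2.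
    by move=> _ [->|->]; exact: K_compact.
  exists (toK cs); first by apply: isLub_K; rewrite image_setU !image_set1.
  move=> a; have [] := sM (val a); rewrite !image_setU !image_set1 => l r.
  by split; apply: isLub_K; rewrite image_setU !image_set1.
(* Distributivity over the empty supremum makes the products of [z] with any element least as well,
   hence equal to [z]. *)
have [z z0 zM] := (pqP Q).1 set0.
have cz : compact z by apply: (compact_isLub _ _ z0) => //; exact: finite_set0.
have zle x : z <= x by move/isLub_set0 : z0.
exists (toK cz) => [x|x]; first by rewrite K_leE /=.
have [] := zM (val x); rewrite !image_set0 => /isLub_set0 xz /isLub_set0 zx.
by split; apply: val_inj; apply: le_anti; rewrite /= zle ?xz ?zx.
Qed.

Lemma K_map_morphism Q Q' (f : pq_hom Q Q') : psl_morphism (K_map f).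
Proof.
have [fM fS _] := svalP f; split=> [x y|X s fX Xs].
  by apply: val_inj; exact: fM.
apply: isLub_K; rewrite image_comp.
by have := fS _ _ (isLub_val fX Xs); rewrite image_comp.
Qed.

Lemma pq_hom_le Q Q' (f : pq_hom Q Q') : {homo sval f : x y / x <= y}.
Proof.
have [_ fS _] := svalP f => x y xy.
by apply: (fS _ _ (isLub2_le xy)).1; exists x => //; left.
Qed.

End Compacts.

(** * Ideals of a prequantic semilattice and their preimages *)

Section IdealCompletion.
Context {d : Order.disp_t}.
Implicit Types M : prequanticSemilattice d.

Lemma Idl_leE M (I J : Idl M) : (I <= J) <-> (val I `<=` val J).
Proof. by rewrite -Order.le_val subsetEset. Qed.

Lemma Idl_down M (I : Idl M) x y : val I y -> x <= y -> val I x.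
Proof. by move=> Iy; apply: (Idl_ideal I).2 Iy. Qed.

Lemma sub_down_join M (X : set M) : X `<=` down_join X.
Proof.
move=> x Xx; exists [set x], x; split=> //.
- by exists x.
- by move=> _ ->.
- by split=> [_ ->//|b]; exact.
Qed.

(** An ideal contains an upper bound of each of its finite subsets, hence everything below their
    suprema; so [down_join X] is the ideal generated by a nonempty [X]. *)
Lemma down_join_sub M (X : set M) (I : Idl M) :
  X `<=` val I -> down_join X `<=` val I.
Proof.
move=> XI y [T [s [fT _ TX [_ lub] ys]]].
have [u Iu ub] := (Idl_ideal I).1.2 T fT (subset_trans TX XI).
by apply: Idl_down Iu _; apply: le_trans ys _; exact: lub.
Qed.

Lemma toIdl_leP M (X : set M) (X0 : X !=set0) (I : Idl M) :
  toIdl (down_join_ideal X0) <= I <-> X `<=` val I.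
Proof.
rewrite Idl_leE; split=> /= [|/down_join_sub//].
by apply: subset_trans; exact: sub_down_join.
Qed.

Lemma idealI M (I : set M) :
  (forall z : M, (forall x, z <= x) -> I z) ->
  (forall x y s : M, isLub [set x; y] s -> I x -> I y -> I s) ->
  (forall x y, I y -> x <= y -> I x) -> ideal I.
Proof.
move=> I0 IU Idown; split=> //; apply: directed2.
  by have [z zle _] := (pslP M).2; exists z; exact: I0.
move=> x y Ix Iy; have [s sxy _] := (pslP M).1 x y.
exists s; first exact: IU sxy Ix Iy.
by split; apply: sxy.1; [left|right].
Qed.

Lemma Idl_bot M (I : Idl M) (z : M) : (forall x, z <= x) -> val I z.
Proof. by move=> zle; have [[[x Ix] _] _] := Idl_ideal I; exact: Idl_down Ix _. Qed.

Lemma Idl_join M (I : Idl M) (x y s : M) :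
  isLub [set x; y] s -> val I x -> val I y -> val I s.
Proof.
move=> xys Ix Iy; apply: (@down_join_sub _ [set x; y] I) => [_ [->|->]//|].
exists [set x; y], s; split=> //.
by exists x; left.
Qed.

(** Applied both to translations by an element and to morphisms. Monotonicity of [h], needed for
    downward closure, comes from preservation of binary joins. *)
Lemma preimage_ideal M M' (h : M -> M') (I : Idl M') :
  (forall z, (forall x, z <= x) -> forall x, h z <= x) ->
  (forall x y s, isLub [set x; y] s -> isLub [set h x; h y] (h s)) ->
  ideal (h @^-1` val I).
Proof.
move=> h0 hU; apply: idealI => [z zle|x y s xys|x y /= Iy xy].
- by apply: Idl_bot; exact: h0.
- by apply: Idl_join; exact: hU.
apply: Idl_down Iy _; apply: (hU _ _ _ (isLub2_le xy)).1; by left.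
Qed.

(** The axiom gives distributivity for some supremum; uniqueness of suprema transfers it to the
    given [s]. *)
Lemma isLub2_mul M (a x y s : M) : isLub [set x; y] s ->
  isLub [set (a * x)%g; (a * y)%g] (a * s)%g /\
  isLub [set (x * a)%g; (y * a)%g] (s * a)%g.
Proof.
move=> xys; have [t xyt tM] := (pslP M).1 x y; rewrite (_ : s = t) //.
by apply: le_anti; rewrite xys.2 ?xyt.2 //; [exact: xys.1|exact: xyt.1].
Qed.

Lemma bot_mul M (a z : M) : (forall x, z <= x) ->
  (a * z = z)%g /\ (z * a = z)%g.
Proof.
move=> zle; have [t tle tM] := (pslP M).2; rewrite (_ : z = t).
  by have [] := tM a.
by apply: le_anti; rewrite zle tle.
Qed.

Lemma preimage_mull_ideal M (a : M) (I : Idl M) :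
  ideal [set x | val I (a * x)%g].
Proof.
apply: (@preimage_ideal _ _ (fun x => a * x)%g I) => [z zle x|x y s].
  by rewrite (bot_mul a zle).1.
by move=> /(isLub2_mul a)[].
Qed.

Lemma preimage_mulr_ideal M (a : M) (I : Idl M) :
  ideal [set x | val I (x * a)%g].
Proof.
apply: (@preimage_ideal _ _ (fun x => x * a)%g I) => [z zle x|x y s].
  by rewrite (bot_mul a zle).2.
by move=> /(isLub2_mul a)[].
Qed.

Lemma preimage_hom_ideal M M' (g : psl_hom M M') (I : Idl M') :
  ideal (sval g @^-1` val I).
Proof.
have [_ gS] := svalP g; apply: preimage_ideal => [z|x y s xys].
  move=> /isLub_set0/(gS _ _ (finite_set0 _)).
  by rewrite image_set0 => /isLub_set0.
by have := gS _ _ (finite_set2 _ _) xys; rewrite image_setU !image_set1.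
Qed.

Lemma Idl_mul_leP M (I J B : Idl M) :
  (I * J)%g <= B <-> forall x y, val I x -> val J y -> val B (x * y)%g.
Proof.
split=> [/toIdl_leP IJB x y Ix Jy|IJB]; first by apply: IJB; exists x => //; exists y.
by apply/toIdl_leP => _ [x Ix [y Jy <-]]; exact: IJB.
Qed.

Lemma Idl_map_leP M M' (g : psl_hom M M') (I : Idl M) (B : Idl M') :
  Idl_map g I <= B <-> forall x, val I x -> val B (sval g x).
Proof.
split=> [/toIdl_leP IB x Ix|IB]; first by apply: IB; exists x.
by apply/toIdl_leP => _ [x Ix <-]; exact: IB.
Qed.

Lemma Idl_prequantale M : prequantale (Idl M).
Proof.
move=> X; have [z zle _] := (pslP M).2.
(* Adjoining the least element [z] keeps [U] nonempty when [X] is empty, and adds nothing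
   otherwise. *)
pose U : set M := z |` \bigcup_(I in X) val I.
have U0 : U !=set0 by exists z; left.
exists (toIdl (down_join_ideal U0)).
  split=> [I XI|B bB].
    by apply/Idl_leE => x Ix; apply: sub_down_join; right; exists I.
  apply/toIdl_leP => x [->|[I XI Ix]]; first exact: Idl_bot.
  by have /Idl_leE := bB _ XI; apply.
move=> J; set s := toIdl _.
have Xs I : X I -> I <= s.
  by move=> XI; apply/Idl_leE => x Ix; apply: sub_down_join; right; exists I.
have sX (B : Idl M) : (forall I, X I -> I <= B) -> s <= B.
  move=> XB; apply/toIdl_leP => x [->|[I XI Ix]]; first exact: Idl_bot.
  by have /Idl_leE := XB _ XI; apply.
split; split=> [_ [I XI <-]|B bB].
- by apply: le_mulg2 => //; exact: Xs.
(* With [x] fixed, the claim says that [s] lies in the residual ideal of all [t] with [x * t] in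
   [B], which can be tested on the members of [X]. *)
- apply/Idl_mul_leP => x y Jx; suff /Idl_leE :
    s <= toIdl (preimage_mull_ideal x B) by apply.
  apply: sX => I XI; apply/Idl_leE => t It /=.
  have /Idl_mul_leP : (J * I)%g <= B by apply: bB; exists I.
  exact.
- by apply: le_mulg2 => //; exact: Xs.
- apply/Idl_mul_leP => x y + Jy; suff /Idl_leE :
    s <= toIdl (preimage_mulr_ideal y B) by apply.
  apply: sX => I XI; apply/Idl_leE => t It /=.
  have /Idl_mul_leP : (I * J)%g <= B by apply: bB; exists I.
  exact.
Qed.

(** * Principal ideals as the compact elements of the ideal completion *)

Lemma principal_ideal M (x : M) : ideal [set y | y <= x].
Proof.
apply: idealI => [z|y z s yzs yx zx|y z zx yz]; first exact.
  by apply: yzs.2 => _ [->|->].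
exact: le_trans yz zx.
Qed.

Definition principal M (x : M) : Idl M := toIdl (principal_ideal x).

Lemma principal_leP M (x : M) (I : Idl M) : principal x <= I <-> val I x.
Proof.
split=> [/Idl_leE|Ix]; first by apply; exact: lexx.
by apply/Idl_leE => y /=; exact: Idl_down.
Qed.

Lemma principal_le M : {mono @principal M : x y / x <= y}.
Proof. by move=> x y; apply/idP/idP => [/principal_leP|xy] //; apply/principal_leP. Qed.

Lemma principal_mul M : {morph @principal M : x y / (x * y)%g}.
Proof.
move=> x y; apply: le_anti; apply/andP; split.
  have /Idl_mul_leP : (principal x * principal y)%g <= (principal x * principal y)%g.
    exact: lexx.
  by move=> H; apply/principal_leP; apply: H; exact: lexx.
by apply/Idl_mul_leP => a b /= ax bx; exact: le_mulg2.
Qed.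

Lemma Idl_map_principal M M' (g : psl_hom M M') (x : M) :
  Idl_map g (principal x) = principal (sval g x).
Proof.
have gx : val (Idl_map g (principal x)) (sval g x).
  by move/Idl_map_leP: (lexx (Idl_map g (principal x))); apply; exact: lexx.
apply: le_anti; apply/andP; split; last by apply/principal_leP.
apply/Idl_map_leP => y /= yx.
suff /Idl_leE : principal x <= toIdl (preimage_hom_ideal g (principal (sval g x))).
  by apply.
by apply/principal_leP; exact: lexx.
Qed.

Lemma bigcup_ideal M (D : set (Idl M)) :
  directed D -> ideal (\bigcup_(I in D) val I).
Proof.
move=> [[I0 DI0] dD]; apply: idealI => [z zle|x y s xys [I DI Ix] [J DJ Jy]|].
- by exists I0 => //; exact: Idl_bot.
- have [||B DB bB] := dD [set I; J]; first exact: finite_set2.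
    by move=> _ [->|->].
  have /Idl_leE IB : I <= B by apply: bB; left.
  have /Idl_leE JB : J <= B by apply: bB; right.
  by exists B => //; apply: Idl_join xys _ _; [exact: IB|exact: JB].
by move=> x y [I DI Iy] xy; exists I => //; exact: Idl_down xy.
Qed.

(** A directed union of ideals is an ideal, so it contains the supremum [s]; an element [x] of [s]
    therefore already lies in a member of [D]. *)
Lemma principal_compact M (x : M) : compact (principal x).
Proof.
move=> D s dD [_ lub] xs.
have /Idl_leE : s <= toIdl (bigcup_ideal dD).
  by apply: lub => I DI; apply/Idl_leE => y Iy; exists I.
move/principal_leP: xs => sx /(_ _ sx)[I DI Ix].
by exists I => //; apply/principal_leP.
Qed.

Lemma Idl_isLub_principal M (I : Idl M) : isLub (@principal M @` val I) I.
Proof.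
split=> [_ [x Ix <-]|B bB]; first by apply/principal_leP.
by apply/Idl_leE => x Ix; apply/principal_leP; apply: bB; exists x.
Qed.

(** [I] is the directed supremum of the principal ideals of its elements, so compactness puts it
    below one of them. *)
Lemma compact_principal M (I : Idl M) : compact I -> exists x, principal x = I.
Proof.
move=> cI; have [|_ [x Ix <-] Ile] := cI _ I _ (Idl_isLub_principal I) (lexx I).
  apply: directed_image (Idl_ideal I).1 => x y; by rewrite principal_le.
by exists x; apply: le_anti; rewrite Ile andbT; apply/principal_leP.
Qed.

Lemma Idl_precoherent_prequantale M : precoherent_prequantale (Idl M).
Proof.
split; first exact: Idl_prequantale.
split=> [I|I J /compact_principal[x <-] /compact_principal[y <-]].
  exists (@principal M @` val I); last exact: Idl_isLub_principal.
  by move=> _ [x _ <-]; exact: principal_compact.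
by rewrite -principal_mul; exact: principal_compact.
Qed.

(** * Action of the ideal completion on morphisms *)

Lemma Idl_map_mem M M' (g : psl_hom M M') (I : Idl M) x :
  val I x -> val (Idl_map g I) (sval g x).
Proof. by move/Idl_map_leP: (lexx (Idl_map g I)); apply. Qed.

Lemma Idl_mul_mem M (I J : Idl M) x y :
  val I x -> val J y -> val (I * J)%g (x * y)%g.
Proof. by move/Idl_mul_leP: (lexx (I * J)%g); apply. Qed.

Lemma Idl_map_morphism M M' (g : psl_hom M M') : pq_morphism (Idl_map g).
Proof.
have gM : {morph sval g : x y / (x * y)%g} by have [] := svalP g.
split=> [I J|X s [ub lub]|I /compact_principal[x <-]].
- apply: le_anti; apply/andP; split.
    apply/Idl_map_leP; apply/(Idl_leE (I * J)%g
      (toIdl (preimage_hom_ideal g (Idl_map g I * Idl_map g J)%g))).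
    apply/Idl_mul_leP => x y Ix Jy /=.
    by rewrite gM; exact: (Idl_mul_mem (Idl_map_mem g Ix) (Idl_map_mem g Jy)).
  (* The factors are reduced to generators one at a time: first [u] to some [g x] with [v] fixed,
     then [v] to some [g y], each by a residual ideal of [B]. *)
  set B := Idl_map g (I * J)%g; apply/Idl_mul_leP => u v + Jv; move: u.
  apply/(Idl_leE _ (toIdl (preimage_mulr_ideal v B))).
  apply/Idl_map_leP => x Ix /=; move: v Jv.
  apply/(Idl_leE _ (toIdl (preimage_mull_ideal (sval g x) B))).
  apply/Idl_map_leP => y Jy /=.
  by rewrite -gM; exact: (Idl_map_mem g (Idl_mul_mem Ix Jy)).
- split=> [_ [I XI <-]|B bB].
    by apply/Idl_map_leP => x /((Idl_leE _ _).1 (ub _ XI)); exact: Idl_map_mem.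
  apply/Idl_map_leP; apply/(Idl_leE _ (toIdl (preimage_hom_ideal g B))).
  apply: lub => I XI; apply/Idl_leE => x Ix /=.
  have /Idl_map_leP : Idl_map g I <= B by apply: bB; exists I.
  exact.
by rewrite Idl_map_principal; exact: principal_compact.
Qed.

Lemma Idl_map_id M (I : Idl M) : Idl_map (psl_id M) I = I.
Proof.
apply: le_anti; apply/andP; split; first exact/Idl_map_leP.
by apply/Idl_leE => x; exact: (@Idl_map_mem _ _ (psl_id M)).
Qed.

Lemma Idl_map_comp M M' M'' (g : psl_hom M' M'') (f : psl_hom M M') (I : Idl M) :
  Idl_map (psl_comp g f) I = Idl_map g (Idl_map f I).
Proof.
apply: le_anti; apply/andP; split.
  by apply/Idl_map_leP => x Ix; do 2 apply: Idl_map_mem.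
apply/Idl_map_leP.
apply/(Idl_leE _ (toIdl (preimage_hom_ideal g (Idl_map (psl_comp g f) I)))).
by apply/Idl_map_leP => x Ix /=; exact: (@Idl_map_mem _ _ (psl_comp g f)).
Qed.

End IdealCompletion.

(** * The two natural isomorphisms *)

Section Equivalence.
Context {d : Order.disp_t}.
Implicit Types (Q : precoherentPrequantale d) (M : prequanticSemilattice d).

Let KM Q : prequanticSemilattice d := PrequanticSemilattice (@K_prequantic d Q).
Let IQ M : precoherentPrequantale d :=
  PrecoherentPrequantale (@Idl_precoherent_prequantale d M).

Lemma compacts_below_ideal Q (x : Q) : ideal [set k : KM Q | val k <= x].
Proof.
apply: (@idealI _ (KM Q)) => [z zle|j k s jks jx kx|j k /= kx jk].
(* [z] is least only among compact elements; since the least element [t] of [Q] is compact, [z] lies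
   below it and hence below [x]. *)
- have [t /isLub_set0 tle _] := (pqP Q).1 set0.
  have ct : compact t.
    by apply: (@compact_isLub _ _ set0) => //; apply/isLub_set0.
  apply: le_trans (tle x); exact: (zle (toK ct)).
- have [_] := isLub_val (finite_set2 _ _) jks; apply.
  by move=> _ [k' [->|->] <-].
by apply: le_trans kx; rewrite -K_leE.
Qed.

Definition compacts_below Q (x : Q) : IQ (KM Q) := toIdl (compacts_below_ideal x).

Lemma isLub_compacts_below Q (x : Q) :
  isLub (val @` [set k : KM Q | val k <= x]) x.
Proof.
split=> [_ [k kx <-]//|b bb]; have [X cX [ub lub]] := (pqP Q).2.1 x.
apply: lub => y Xy; apply: bb.
by exists (toK (cX _ Xy)) => //; exact: ub.
Qed.

Lemma directed_val Q (I : Idl (KM Q)) : directed (val @` val I).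
Proof. by apply: directed_image (Idl_ideal I).1 => x y; rewrite -K_leE. Qed.

Lemma compacts_below_le Q : {mono @compacts_below Q : x y / x <= y}.
Proof.
move=> x y; apply/idP/idP => [/Idl_leE xy|xy].
  by apply: (isLub_compacts_below x).2 => _ [k /xy kx <-].
by apply/Idl_leE => k /= kx; exact: le_trans kx xy.
Qed.

(** Take for [x] the supremum of [I] in [Q]: as [I] is directed, a compact element below it lies
    below a member of [I]. *)
Lemma compacts_below_surj Q (I : IQ (KM Q)) : exists x, compacts_below x = I.
Proof.
have [s sI _] := (pqP Q).1 (val @` val I).
exists s; apply: le_anti; apply/andP; split; apply/Idl_leE => k /= ks.
  have [_ [j Ij <-] kj] := directed_isLub_compact (directed_val I) sI (@K_compact _ _ k) ks.
  by apply: (Idl_down Ij); rewrite K_leE.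
by apply: sI.1; exists k.
Qed.

Lemma compacts_below_mul Q : {morph @compacts_below Q : x y / (x * y)%g}.
Proof.
move=> x y; apply: le_anti; apply/andP; split; last first.
  by apply/Idl_mul_leP => j k /= jx ky; exact: le_mulg2.
(* Writing the product ideal as [compacts_below t] reduces the inclusion to [x * y <= t], which
   distributivity reduces to products of compact elements. *)
have [t tE] := compacts_below_surj (compacts_below x * compacts_below y)%g.
have mul_lub (X : set Q) s a : isLub X s ->
    isLub [set (a * x)%g | x in X] (a * s)%g /\
    isLub [set (x * a)%g | x in X] (s * a)%g.
  move=> Xs; have [u Xu uM] := (pqP Q).1 X; rewrite (_ : s = u) //.
  by apply: le_anti; rewrite Xs.2 ?Xu.2 //; [exact: Xs.1|exact: Xu.1].
rewrite -tE compacts_below_le.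
apply: (mul_lub _ _ y (isLub_compacts_below x)).2.2 => _ [_ [j jx <-] <-].
apply: (mul_lub _ _ _ (isLub_compacts_below y)).1.2 => _ [_ [k ky <-] <-].
suff : val (compacts_below t) (j * k)%g by [].
by rewrite tE; exact: Idl_mul_mem.
Qed.

(** [f x] is the directed supremum of the images of the compact elements below [x], so a compact
    element below [f x] lies below one of these images. *)
Lemma compacts_below_natural Q Q' (f : pq_hom Q Q')
    (g : psl_hom (KM Q) (KM Q')) (x : Q) :
  (forall k, val (sval g k) = sval f (val k)) ->
  Idl_map g (compacts_below x) = compacts_below (sval f x).
Proof.
move=> gE; apply: le_anti; apply/andP; split.
  by apply/Idl_map_leP => k /= kx; rewrite gE; exact: pq_hom_le.
apply/Idl_leE => k /= kfx; have [_ fS _] := svalP f.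
have dX := directed_image (@pq_hom_le _ _ _ f) (directed_val (compacts_below x)).
have [_ [_ [j jx <-] <-] kj] :=
  directed_isLub_compact dX (fS _ _ (isLub_compacts_below x))
    (@K_compact _ _ k) kfx.
by apply: (Idl_down (Idl_map_mem g jx)); rewrite K_leE gE.
Qed.

Definition principalK M (x : M) : KM (IQ M) :=
  toK (@principal_compact d M x : compact (principal x : IQ M)).

Lemma principalK_le M : {mono @principalK M : x y / x <= y}.
Proof. by move=> x y; rewrite K_leE /= principal_le. Qed.

Lemma principalK_mul M : {morph @principalK M : x y / (x * y)%g}.
Proof. by move=> x y; apply: val_inj; exact: principal_mul. Qed.

Lemma principalK_surj M (I : KM (IQ M)) : exists x, principalK x = I.
Proof.
by have [x xI] := compact_principal (@K_compact _ _ I); exists x; exact: val_inj.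
Qed.

End Equivalence.

(* The existential quantifiers range over proofs and are dependent conjunctions:
   K(Q) and Idl(M) are objects of the target categories, then (1), (2) and (3). *)
Theorem theorem7p7 (d : Order.disp_t) :
  exists (K_ob : forall Q : precoherentPrequantale d,
            prequantic_semilattice (K Q))
         (Idl_ob : forall M : prequanticSemilattice d,
            precoherent_prequantale (Idl M))
         (K_mor : forall (Q Q' : precoherentPrequantale d) (f : pq_hom Q Q'),
            psl_morphism (K_map f))
         (Idl_mor : forall (M M' : prequanticSemilattice d) (g : psl_hom M M'),
            pq_morphism (Idl_map g)),
    category_equivalence (K_functor K_ob K_mor) (Idl_functor Idl_ob Idl_mor).
Proof.
exists (@K_prequantic d), (@Idl_precoherent_prequantale d).
exists (@K_map_morphism d), (@Idl_map_morphism d); split.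
- split=> [Q|Q Q' Q'' g f]; apply: psl_hom_eq; apply/funext => x; exact: val_inj.
- split=> [M|M M' M'' g f]; apply: pq_hom_eq; apply/funext => I.
    exact: Idl_map_id.
  exact: Idl_map_comp.
(* The components are the maps [compacts_below], from [Q] to the ideals of [K Q]. *)
- apply: naturally_isomorphic_sym.
  have bij Q := mono_bij (@compacts_below_le d Q) (@compacts_below_surj d Q).
  exists (fun Q => exist _ (@compacts_below d Q) (pq_morphism_iso (bij Q)
    (@compacts_below_le d Q) (@compacts_below_mul d Q))).
    by move=> Q; apply: is_iso_PQ; [exact: bij|exact: compacts_below_le].
  move=> Q Q' f; apply: pq_hom_eq; apply/funext => x.
  by symmetry; exact: compacts_below_natural.
(* The components are the maps [principalK]; naturality is the fact that [Idl_map g] sends principal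
   ideals to principal ideals. *)
- apply: naturally_isomorphic_sym.
  have bij M := mono_bij (@principalK_le d M) (@principalK_surj d M).
  exists (fun M => exist _ (@principalK d M) (psl_morphism_iso (bij M)
    (@principalK_le d M) (@principalK_mul d M))).
    by move=> M; apply: is_iso_PSL; [exact: bij|exact: principalK_le].
  move=> M M' g; apply: psl_hom_eq; apply/funext => x; apply: val_inj.
  by symmetry; exact: Idl_map_principal.
Qed.
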